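(* Let $\mathcal{S}=\{p_1,\dots,p_n\}\subset \mathbb{R}^d/\mathbb{R}\mathbf{1}$ be any finite collection of points. Then the set of tropical Fermat-Weber points $$\mathrm{FW}(\mathcal{S})=\Big\{x^*\in\mathbb{R}^d/\mathbb{R}\mathbf{1} \;:\; x^*\in\arg\min_x \sum_{i=1}^n d_{\mathrm{tr}}(x,p_i)\Big\}$$ is a polytrope in $\mathbb{R}^d/\mathbb{R}\mathbf{1}$. Moreover, this polytrope is a unique maximal cell of the bi-tropical covector decomposition $\mathrm{BCD}(\mathcal{S})$, i.e. $\mathrm{FW}(\mathcal{S})$ coincides with a single closed cell of $\mathrm{BCD}(\mathcal{S})$.
   Context: $\mathbb{R}^d/\mathbb{R}\mathbf{1}$ is the tropical projective torus, the quotient of $\mathbb{R}^d$ by the line spanned by $\mathbf{1}=(1,\dots,1)$, identified with $\mathbb{R}^{d-1}$ via $x\mapsto(0,x_2-x_1,\dots,x_d-x_1)$. The (symmetric) tropical metric is $d_{\mathrm{tr}}(u,v)=\max_{j\in[d]}(u_j-v_j)-\min_{k\in[d]}(u_k-v_k)$. A subset $P$ is tropically convex if for all $u,v\in P$ and $a,b\in\mathbb{R}$ the componentwise maximum $\max(a+u,b+v)$ lies in $P$; a polytrope is a subset that is both classically convex (in $\mathbb{R}^{d-1}$) and tropically convex. Let $V$ be the $n\times d$ real matrix whose $i$-th row $v_i$ is $p_i$. For $x\in\mathbb{R}^d/\mathbb{R}\mathbf{1}$ define the max covector graph $G_V(x)=\{(i,j): j\in\arg\max_{k}(x_k-v_{ik})\}$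 and the min covector graph $\overline{G}_V(x)=\{(j,i): j\in\arg\min_{k}(x_k-v_{ik})\}$. The bi-tropical covector decomposition $\mathrm{BCD}(\mathcal{S})$ is the polyhedral subdivision of $\mathbb{R}^d/\mathbb{R}\mathbf{1}$ induced by the union of the max-plus tropical hyperplanes and the min-plus tropical hyperplanes with apices $p_1,\dots,p_n$; its closed cells are the sets $C(x)=\{y: x_\cdot \text{ replaced by } y \text{ satisfies } y_j-y_k\ge v_{ij}-v_{ik}\ \forall (i,j)\in G_V(x),k\in[d];\ y_j-y_k\le v_{ij}-v_{ik}\ \forall (j,i)\in\overline{G}_V(x),k\in[d]\}$, equivalently $C(x)=\{y: G_V(y)\supseteq G_V(x),\ \overline{G}_V(y)\supseteq\overline{G}_V(x)\}$, for $x\in\mathbb{R}^d/\mathbb{R}\mathbf{1}$. *)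

(* Defs.v *)
From HB Require Import structures.
From mathcomp Require Import all_boot all_order all_algebra.
From mathcomp Require Import all_classical all_reals convex lra.

Set Implicit Arguments.
Unset Strict Implicit.
Unset Printing Implicit Defensive.

Import Order.TTheory GRing.Theory Num.Theory.

Local Open Scope classical_set_scope.
Local Open Scope ring_scope.
Local Open Scope quotient_scope.

Definition argmin {R : realType} {T : Type} (f : T -> R) : set T :=
  [set x | forall y, f x <= f y].

Definition argmax {R : realType} {T : Type} (f : T -> R) : set T :=
  [set x | forall y, f y <= f x].

Definition maximal_set {T : Type} (F : set (set T)) (A : set T) : Prop :=
  F A /\ forall B, F B -> A `<=` B -> B = A.

Section TropicalTorus.
Variables (R : realType) (d : nat).
Local Notation vec := 'rV[R]_d.+1.
Implicit Types (u v w : vec).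

Definition ones_line : {vspace vec} := <[const_mx 1]>%VS.

(* The ambient dimension is d.+1, so that the torus has dimension d. *)
Definition torus := Quotient.quot ones_line.

Definition pt (u : vec) : torus := \pi_torus u.

(* The functions below are defined on a class through the representative
   [repr x]; [chart_pt], [dtr_pt], [max_covector_pt], [min_covector_pt] and
   [cell_pt] show that any representative may be used. *)

Definition chart (x : torus) : 'rV[R]_d :=
  \row_j (repr x 0 (lift ord0 j) - repr x 0 ord0).

Definition spread (w : vec) : R :=
  \big[Num.max/w 0 ord0]_j w 0 j - \big[Num.min/w 0 ord0]_j w 0 j.

Definition dtr (x y : torus) : R := spread (repr x - repr y).

Definition tropically_convex (P : set torus) : Prop :=
  forall u v (a b : R), P (pt u) -> P (pt v) ->
    P (pt (map2_mx Num.max (const_mx a + u) (const_mx b + v))).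

Definition classically_convex (P : set torus) : Prop :=
  convex_set (chart @` P : set (convex_lmodType 'rV[R]_d)).

Definition polytrope (P : set torus) : Prop :=
  classically_convex P /\ tropically_convex P.

Definition fermat_weber {n : nat} (p : 'I_n -> torus) : set torus :=
  argmin (fun x => \sum_(i < n) dtr x (p i)).

Section Covector.
Variables (n : nat) (V : 'M[R]_(n, d.+1)).

Definition max_covector (x : torus) : set ('I_n * 'I_d.+1) :=
  [set ij | argmax (fun k => repr x 0 k - V ij.1 k) ij.2].

Definition min_covector (x : torus) : set ('I_d.+1 * 'I_n) :=
  [set ji | argmin (fun k => repr x 0 k - V ji.2 k) ji.1].

Definition cell (x : torus) : set torus :=
  [set y : torus | (forall i j k, max_covector x (i, j) ->
              V i j - V i k <= repr y 0 j - repr y 0 k) /\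
           (forall i j k, min_covector x (j, i) ->
              repr y 0 j - repr y 0 k <= V i j - V i k)].

(* The subdivision is represented by the set of its closed cells. *)
Definition BCD : set (set torus) := range cell.

End Covector.

Lemma pt_eqP u v : pt u = pt v <-> exists c : R, u = const_mx c + v.
Proof.
have e : (pt u = pt v) <-> (u - v \in ones_line).
  by rewrite Quotient.idealrBE; split=> [uv|/eqP//]; apply/eqP.
rewrite e; split=> [/vlineP[c uv]|[c ->]].
  exists c; rewrite -[u](subrK v) uv; congr (_ + _).
  by apply/rowP => j; rewrite !mxE mulr1.
rewrite addrK; apply/vlineP; exists c.
by apply/rowP => j; rewrite !mxE mulr1.
Qed.

Lemma repr_pt u : exists c : R, repr (pt u) = const_mx c + u.
Proof. by apply/pt_eqP; rewrite /pt reprK. Qed.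

Lemma chart_pt u : chart (pt u) = \row_j (u 0 (lift ord0 j) - u 0 ord0).
Proof.
have [c uE] := repr_pt u; apply/rowP => j.
by rewrite !mxE uE !mxE opprD addrACA subrr add0r.
Qed.

Lemma chart_inj : injective chart.
Proof.
move=> x y /rowP xy; rewrite -[x]reprK -[y]reprK; apply/pt_eqP.
exists (repr x 0 ord0 - repr y 0 ord0); apply/rowP => j; rewrite !mxE.
have [j' ->|->] := unliftP ord0 j.
  by have := xy j'; rewrite !mxE; lra.
by rewrite subrK.
Qed.

Lemma chart_surj (y : 'rV[R]_d) : exists x, chart x = y.
Proof.
exists (pt (\row_j (if unlift ord0 j is Some k then y 0 k else 0))).
rewrite chart_pt; apply/rowP => j; rewrite !mxE liftK.
by case: unliftP => [k /eqP|_]; rewrite ?(negPf (neq_lift _ _)) ?subr0.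
Qed.

Lemma spread_shift c w : spread (const_mx c + w) = spread w.
Proof.
have Emax : \big[Num.max/(const_mx c + w) 0 ord0]_j (const_mx c + w) 0 j =
    c + \big[Num.max/w 0 ord0]_j w 0 j.
  rewrite (big_morph (fun t => c + t) (addr_maxr c) (erefl (c + w 0 ord0))).
  by rewrite !mxE; apply: eq_bigr => j _; rewrite !mxE.
have Emin : \big[Num.min/(const_mx c + w) 0 ord0]_j (const_mx c + w) 0 j =
    c + \big[Num.min/w 0 ord0]_j w 0 j.
  rewrite (big_morph (fun t => c + t) (addr_minr c) (erefl (c + w 0 ord0))).
  by rewrite !mxE; apply: eq_bigr => j _; rewrite !mxE.
by rewrite /spread Emax Emin opprD addrACA subrr add0r.
Qed.

Lemma dtr_pt u v : dtr (pt u) (pt v) = spread (u - v).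
Proof.
have [b uE] := repr_pt u; have [c vE] := repr_pt v.
rewrite /dtr uE vE -[RHS](spread_shift (b - c)); congr (spread _).
by apply/rowP => j; rewrite !mxE opprD addrACA.
Qed.

Section CovectorLemmas.
Variables (n : nat) (V : 'M[R]_(n, d.+1)).

Lemma max_covector_pt u i j :
  max_covector V (pt u) (i, j) <-> argmax (fun k => u 0 k - V i k) j.
Proof.
have [c uE] := repr_pt u; rewrite /max_covector /argmax /= uE.
by split=> h k; have := h k; rewrite !mxE -!addrA lerD2l.
Qed.

Lemma min_covector_pt u i j :
  min_covector V (pt u) (j, i) <-> argmin (fun k => u 0 k - V i k) j.
Proof.
have [c uE] := repr_pt u; rewrite /min_covector /argmin /= uE.
by split=> h k; have := h k; rewrite !mxE -!addrA lerD2l.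
Qed.

Lemma cell_pt x u : cell V x (pt u) <->
  (forall i j k, max_covector V x (i, j) -> V i j - V i k <= u 0 j - u 0 k) /\
  (forall i j k, min_covector V x (j, i) -> u 0 j - u 0 k <= V i j - V i k).
Proof.
have [c uE] := repr_pt u; rewrite /cell /= uE.
have sub j k : (const_mx c + u) 0 j - (const_mx c + u) 0 k = u 0 j - u 0 k.
  by rewrite !mxE opprD addrACA subrr add0r.
by split=> -[h1 h2]; split=> i j k hij; move: (h1 i j k) (h2 i j k);
  rewrite ?sub; auto.
Qed.

Lemma cellE x : cell V x =
  [set y : torus | max_covector V x `<=` max_covector V y /\
           min_covector V x `<=` min_covector V y].
Proof.
apply/seteqP; split=> y [h1 h2]; split.
- by move=> [i j] hij k /=; have := h1 i j k hij; lra.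
- by move=> [j i] hij k /=; have := h2 i j k hij; lra.
- by move=> i j k hij; have /= := h1 (i, j) hij k; lra.
- by move=> i j k hij; have /= := h2 (j, i) hij k; lra.
Qed.

End CovectorLemmas.
End TropicalTorus.

(* Main.v *)
Require Import Defs.
From HB Require Import structures.
From mathcomp Require Import all_boot all_order all_algebra.
From mathcomp Require Import all_classical all_reals.
From mathcomp Require Import interval_inference topology normedtype derive.
From mathcomp Require Import lra.

Set Implicit Arguments.
Unset Strict Implicit.
Unset Printing Implicit Defensive.

Import Order.TTheory GRing.Theory Num.Theory.
Import numFieldNormedType.Exports.

Local Open Scope classical_set_scope.
Local Open Scope ring_scope.

(* On vectors, [F u = \sum_i spread (u - v_i)] has a minimizer, by compactness.
   Equality in the subadditivity of [spread] shows that the midpoint of two minimizers is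
   a minimizer whose covectors are contained in those of both. Hence a minimizer
   [x] with inclusion-minimal covectors has its covectors contained in those of
   every minimizer, that is, all minimizers lie in the cell of [x]. Conversely
   [F] is affine on that cell and minimal at its relative interior point [x], so
   it is constant there. *)

(** * Finite extrema and continuity of iterated operations *)

Lemma ex_argmax (R : realType) (d : nat) (f : 'I_d.+1 -> R) : exists j, argmax f j.
Proof.
by case: (@arg_maxP _ _ _ ord0 predT f) => // j _ jmax; exists j => k; apply: jmax.
Qed.

Lemma ex_argmin (R : realType) (d : nat) (f : 'I_d.+1 -> R) : exists j, argmin f j.
Proof.
by case: (@arg_minP _ _ _ ord0 predT f) => // j _ jmin; exists j => k; apply: jmin.
Qed.

(** Only the indices with [0 < b t] restrict [e], and there are finitely many. The summand 1 keeps
    the denominators positive, and the default 1 of the minimum serves when no such index exists. *)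
Lemma exists_small_multiple (R : realType) (T : finType) (a b : T -> R) :
  (forall t, 0 <= b t) -> (forall t, b t = 0 -> a t <= 0) ->
  exists2 e : R, 0 < e & forall t, e * a t <= b t.
Proof.
move=> b_ge0 ab0.
exists (\big[Num.min/1]_(t | 0 < b t) (b t / (1 + `|a t|))).
  by apply: lt_bigmin => // t bt; rewrite divr_gt0// ltr_wpDr.
move=> t; set e := \big[_/_]_(_ | _) _.
have e_ge0 : 0 <= e.
  by apply: le_bigmin => // s bs; rewrite divr_ge0// addr_ge0.
have [at_le0|at_gt0] := leP (a t) 0.
  by rewrite (le_trans _ (b_ge0 t))// mulr_ge0_le0.
have bt : 0 < b t.
  rewrite lt_neqAle b_ge0 andbT; apply/negP => /eqP/esym/ab0.
  by rewrite leNgt at_gt0.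
have : e <= b t / (1 + `|a t|) by exact: bigmin_le_cond.
rewrite ler_pdivlMr ?ltr_wpDr// gtr0_norm// => h.
by rewrite (le_trans _ h)// ler_wpM2l// lerDr.
Qed.

Lemma continuous_big (R : realType) (T : topologicalType) (I : Type)
    (r : seq I) (op : R -> R -> R) (f0 : T -> R) (f : I -> T -> R) :
  (forall g h : T -> R, continuous g -> continuous h ->
     continuous (fun x => op (g x) (h x))) ->
  continuous f0 -> (forall i, continuous (f i)) ->
  continuous (fun x => \big[op/f0 x]_(i <- r) f i x).
Proof.
move=> cop cf0 cf; elim: r => [|i r ih].
  by under eq_fun do rewrite big_nil.
by under eq_fun do rewrite big_cons; exact: cop.
Qed.

(** * The spread as a seminorm *)

Section Spread.
Variables (R : realType) (d : nat).
Implicit Types u w : 'rV[R]_d.+1.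

Lemma spread_ge w j k : w 0 j - w 0 k <= spread w.
Proof. by rewrite lerB// ?le_bigmax ?bigmin_le. Qed.

Lemma spreadE w j k :
  argmax (w 0) j -> argmin (w 0) k -> spread w = w 0 j - w 0 k.
Proof.
move=> jmax kmin; apply/eqP; rewrite eq_le spread_ge andbT.
by rewrite lerB//; [apply: bigmax_le | apply: le_bigmin] => *; auto.
Qed.

Lemma spread_attained w : exists j k, spread w = w 0 j - w 0 k.
Proof.
have [j jmax] := ex_argmax (w 0); have [k kmin] := ex_argmin (w 0).
by exists j, k; exact: spreadE.
Qed.

Lemma spread_eqP w j k :
  spread w = w 0 j - w 0 k <-> argmax (w 0) j /\ argmin (w 0) k.
Proof.
split=> [e|[jmax kmin]]; last exact: spreadE.
by split=> l; [have := spread_ge w l k | have := spread_ge w j l];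
  rewrite e ?lerD2r// lerD2l lerN2.
Qed.

Lemma spread_ge0 w : 0 <= spread w.
Proof. by have := spread_ge w ord0 ord0; rewrite subrr. Qed.

Lemma spreadD u w : spread (u + w) <= spread u + spread w.
Proof.
have [j [k ->]] := spread_attained (u + w); rewrite !mxE.
by have := spread_ge u j k; have := spread_ge w j k; lra.
Qed.

Lemma spread_half w : spread (2^-1 *: w) = 2^-1 * spread w.
Proof.
have [j [k e]] := spread_attained w; rewrite e.
have [jmax kmin] := (spread_eqP w j k).1 e.
rewrite (@spreadE _ j k); first by rewrite !mxE mulrBr.
  by move=> l; rewrite !mxE ler_wpM2l ?invr_ge0 ?ler0n //; exact: jmax.
by move=> l; rewrite !mxE ler_wpM2l ?invr_ge0 ?ler0n //; exact: kmin.
Qed.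

(** A pair [j], [k] attaining the spread of the sum splits it into a difference for [u] and one for
    [w]. Each is at most its own spread, so equality of the totals makes both attained. *)
Lemma spreadD_eq u w : spread (u + w) = spread u + spread w ->
  argmax ((u + w) 0) `<=` argmax (u 0) /\ argmin ((u + w) 0) `<=` argmin (u 0).
Proof.
move=> uw.
have key j k : argmax ((u + w) 0) j -> argmin ((u + w) 0) k ->
    argmax (u 0) j /\ argmin (u 0) k.
  move=> /spreadE h /h{h}; rewrite !mxE uw => e; apply/spread_eqP.
  by have := spread_ge u j k; have := spread_ge w j k; lra.
split=> [j jmax|k kmin].
  by have [k /(key _ _ jmax)[]] := ex_argmin ((u + w) 0).
by have [j /key/(_ kmin)[]] := ex_argmax ((u + w) 0).
Qed.

Lemma spread_continuous : continuous (@spread R d).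
Proof.
have cont_coord (j : 'I_d.+1) : continuous (fun w : 'rV[R]_d.+1 => w 0 j).
  exact: coord_continuous.
move=> w; apply: (@continuousB R R^o _
  (fun w : 'rV[R]_d.+1 => \big[Num.max/w 0 ord0]_j w 0 j)
  (fun w : 'rV[R]_d.+1 => \big[Num.min/w 0 ord0]_j w 0 j)).
- apply: (@continuous_big _ _ _ _ Num.max) => // f g cf cg x.
  exact: (continuous_max (cf x) (cg x)).
- apply: (@continuous_big _ _ _ _ Num.min) => // f g cf cg x.
  exact: (continuous_min (cf x) (cg x)).
Qed.

End Spread.

(** * The total distance on representatives and its minimizers *)

Section FermatWeber.
Variables (R : realType) (d n : nat) (V : 'M[R]_(n, d.+1)).
Implicit Types u v w : 'rV[R]_d.+1.

Definition total_dist u : R := \sum_(i < n) spread (u - row i V).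

Lemma total_dist_shift c u : total_dist (const_mx c + u) = total_dist u.
Proof. by apply: eq_bigr => i _; rewrite -addrA spread_shift. Qed.

Lemma fermat_weber_pt (p : 'I_n -> torus R d) u :
  (forall i, pt (row i V) = p i) ->
  fermat_weber p (pt u) <-> argmin total_dist u.
Proof.
move=> hV.
have e w : \sum_(i < n) dtr (pt w) (p i) = total_dist w.
  by apply: eq_bigr => i _; rewrite -hV dtr_pt.
rewrite /fermat_weber /argmin /=; split=> h y.
  by rewrite -!e; exact: h.
by rewrite -[y]reprK e (e (repr y)); exact: h.
Qed.

Lemma total_dist_continuous : continuous total_dist.
Proof.
apply: (@continuous_big _ _ _ _ +%R (fun=> 0)) => [g h cg ch x||i u].
- exact: (@continuousD R R^o _ g h x (cg x) (ch x)).
- exact: cst_continuous.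
apply: (@continuous_comp _ _ _ (fun u => u - row i V) (@spread R d)).
  by apply: continuousB; [move=> ? | exact: cst_continuous].
exact: spread_continuous.
Qed.

Lemma total_dist_has_min : exists u, argmin total_dist u.
Proof.
case: (posnP n) => [n0|n_gt0].
  exists 0 => w; have no (P : Prop) : 'I_n -> P by case=> ?; rewrite n0.
  by rewrite /total_dist !big1// => i _; exact: no i.
pose i0 := Ordinal n_gt0; pose v0 := row i0 V; pose M := total_dist v0.
have M_ge0 : 0 <= M by apply: sumr_ge0 => i _; exact: spread_ge0.
(* A coordinate box around the site [v0], of radius the value at [v0]: up to a shift, it contains
   every vector whose value is at most [M]. *)
pose box j : set R := `[v0 0 j - M, v0 0 j + M]%classic.
have cbox : compact [set v : 'rV[R]_d.+1 | forall j, box j (v ord0 j)].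
  by apply: rV_compact => j; exact: segment_compact.
have box_v0 : forall j, box j (v0 ord0 j).
  by move=> j; rewrite /box /= in_itv /= lerBlDr lerDl M_ge0.
have [|u _ umin] := EVT_min_rV (f := total_dist) (ex_intro _ v0 box_v0) cbox.
  by apply: continuous_subspaceT => x; exact: total_dist_continuous.
exists u => w.
have [wM|/ltW Mw] := leP (total_dist w) M; last first.
  by apply: le_trans Mw; apply: umin; rewrite inE.
(* This shift makes [w] agree with [v0] at [ord0], so the spread of [w - v0], one term of
   [total_dist w], bounds every coordinate of the difference. *)
pose c := v0 0 ord0 - w 0 ord0.
rewrite -(total_dist_shift c w); apply: umin; rewrite inE => j.
have sM : spread (w - v0) <= M.
  apply: le_trans wM; rewrite /total_dist (bigD1 i0)//= lerDl.
  by apply: sumr_ge0 => i _; exact: spread_ge0.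
have := spread_ge (w - v0) ord0 j; have := spread_ge (w - v0) j ord0.
rewrite /box /= in_itv /= /c; move: sM; rewrite !mxE => *; apply/andP; lra.
Qed.

(* A [{set _}] rather than a pair of classical sets: inclusion-minimal covectors
   then exist among those of the minimizers. *)
Definition covectors u : {set ('I_n * 'I_d.+1) + ('I_d.+1 * 'I_n)} :=
  finset (fun s => match s with
                   | inl ij => `[< max_covector V (pt u) ij >]
                   | inr ji => `[< min_covector V (pt u) ji >] end).

Lemma in_covectors_max u i j :
  inl (i, j) \in covectors u <-> argmax ((u - row i V) 0) j.
Proof.
rewrite !inE; split=> [/max_covector_pt h k|h].
  by have := h k; rewrite !mxE.
by apply/max_covector_pt => k; have := h k; rewrite !mxE.
Qed.

Lemma in_covectors_min u i j :
  inr (j, i) \in covectors u <-> argmin ((u - row i V) 0) j.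
Proof.
rewrite !inE; split=> [/min_covector_pt h k|h].
  by have := h k; rewrite !mxE.
by apply/min_covector_pt => k; have := h k; rewrite !mxE.
Qed.

(** * Comparing minimizers through their covectors *)

Lemma cell_covectors u w :
  cell V (pt u) (pt w) <-> covectors u \subset covectors w.
Proof.
rewrite cellE; split=> [[hmax hmin]|/fintype.subsetP uw].
  by apply/fintype.subsetP => -[ij|ji]; rewrite !inE; [exact: hmax | exact: hmin].
by split=> [ij|ji] h; [have := uw (inl ij) | have := uw (inr ji)];
  rewrite !inE; exact.
Qed.

Lemma spread_covectors u w i j k : covectors u \subset covectors w ->
  spread (u - row i V) = (u - row i V) 0 j - (u - row i V) 0 k ->
  spread (w - row i V) = (w - row i V) 0 j - (w - row i V) 0 k.
Proof.
move=> /fintype.subsetP uw /spread_eqP[jmax kmin]; apply/spread_eqP; split.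
  by apply/in_covectors_max/uw/in_covectors_max.
by apply/in_covectors_min/uw/in_covectors_min.
Qed.

(* [u] lies in the relative interior of its cell, on which [total_dist] is
   affine: the segment from [w] can be extended slightly beyond [u]. *)
Lemma cell_sub_argmin u w : covectors u \subset covectors w ->
  argmin total_dist u -> argmin total_dist w.
Proof.
move=> uw umin x; apply: le_trans (umin x).
(* The slack of the pair [t.2] in the spread for site [t.1]. Inclusion of covectors makes it vanish
   at [w] wherever it vanishes at [u]. *)
pose gap (v : 'rV[R]_d.+1) (t : 'I_n * ('I_d.+1 * 'I_d.+1)) :=
  spread (v - row t.1 V) -
  ((v - row t.1 V) 0 t.2.1 - (v - row t.1 V) 0 t.2.2).
have [t||e e_gt0 he] := @exists_small_multiple R _ (fun t => gap w t - gap u t) (gap u).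
- by rewrite subr_ge0 spread_ge.
- move=> [i [j k]] gu; rewrite gu subr0 /gap /=.
  by rewrite (spread_covectors uw (subr0_eq gu)) subrr.
(* The choice of [e] amounts to [e * gap w t <= (1 + e) * gap u t], which is what bounds the spread
   at [z = (1 + e) u - e w]. *)
pose z := u - e *: (w - u).
have zi i : spread (z - row i V) <=
    (1 + e) * spread (u - row i V) - e * spread (w - row i V).
  have [j [k ->]] := spread_attained (z - row i V).
  by have := he (i, (j, k)); rewrite /gap /= !mxE; lra.
have := umin z.
have : total_dist z <= (1 + e) * total_dist u - e * total_dist w.
  by rewrite /total_dist !mulr_sumr -sumrB ler_sum.
move=> h1 h2; rewrite -(ler_pM2l e_gt0); lra.
Qed.

(** The triangle-inequality gaps are nonnegative, and minimality of [u] and [w] makes their sum at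
    most 0. So each gap vanishes and [spreadD_eq] applies site by site. *)
Lemma midpoint_argmin u w : argmin total_dist u -> argmin total_dist w ->
  let m := 2^-1 *: (u + w) in
  argmin total_dist m /\ covectors m \subset covectors u.
Proof.
move=> umin wmin m.
have mE i : m - row i V = 2^-1 *: ((u - row i V) + (w - row i V)).
  by apply/rowP => j; rewrite !mxE; lra.
pose gap i := spread (u - row i V) + spread (w - row i V) -
  spread ((u - row i V) + (w - row i V)).
have gap_ge0 i : 0 <= gap i by rewrite subr_ge0 spreadD.
have sum_gap : \sum_i gap i = total_dist u + total_dist w - 2 * total_dist m.
  rewrite sumrB big_split /=; congr (_ - _); rewrite mulr_sumr.
  by apply: eq_bigr => i _; rewrite mE spread_half; lra.
have sum_gap_ge0 : 0 <= \sum_i gap i by exact: sumr_ge0.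
have uw := umin w; have wu := wmin u; have um := umin m.
have sum_gap0 : \sum_i gap i = 0 by lra.
split=> [x|].
  by have := umin x; lra.
have gap0 i : gap i = 0.
  by apply: (psumr_eq0P _ sum_gap0) => // j _; exact: gap_ge0.
have mu i : argmax ((m - row i V) 0) `<=` argmax ((u - row i V) 0) /\
            argmin ((m - row i V) 0) `<=` argmin ((u - row i V) 0).
  have [hmax hmin] := spreadD_eq (esym (subr0_eq (gap0 i))).
  split=> j jext; [apply: hmax|apply: hmin] => k;
    by have := jext k; rewrite mE !mxE; lra.
apply/fintype.subsetP => -[[i j] /in_covectors_max h|[j i] /in_covectors_min h].
  by apply/in_covectors_max; exact: (mu i).1.
by apply/in_covectors_min; exact: (mu i).2.
Qed.

(** * The Fermat-Weber set as a cell, and cells as polytropes *)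

Lemma fermat_weber_cell (p : 'I_n -> torus R d) :
  (forall i, pt (row i V) = p i) -> BCD V (fermat_weber p).
Proof.
move=> hV.
have [u0 u0min] := total_dist_has_min.
pose attained (A : {set ('I_n * 'I_d.+1) + ('I_d.+1 * 'I_n)}) :=
  `[< exists2 u, argmin total_dist u & covectors u = A >].
have [|A /minsetP[/asboolP[u umin uA] Amin]] := @ex_minset _ attained.
  by exists (covectors u0); apply/asboolP; exists u0.
exists (pt u) => //; apply/seteqP; split=> y; rewrite -[y]reprK.
  move=> /cell_covectors uy; apply/(fermat_weber_pt _ hV).
  exact: cell_sub_argmin uy umin.
move=> /(fermat_weber_pt _ hV) ymin; apply/cell_covectors.
have [mmin mu] := midpoint_argmin umin ymin.
have [_ my] := midpoint_argmin ymin umin.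
(* The midpoint is a minimizer with covectors inside those of [u]; minimality of [A] forces
   equality. *)
have <- : covectors (2^-1 *: (u + repr y)) = covectors u.
  rewrite uA; apply: Amin; last by rewrite -uA.
  by apply/asboolP; exists (2^-1 *: (u + repr y)).
by rewrite addrC.
Qed.

(** Cell inequalities bound coordinate differences. They are linear, and survive a componentwise
    maximum: whichever argument attains the maximum on the smaller side, its own inequality
    suffices. *)
Lemma cell_polytrope x : polytrope (cell V x).
Proof.
split.
  move=> a b l; rewrite !inE => -[y hy <-] [z hz <-].
  move: hy hz; rewrite -[y]reprK -[z]reprK.
  move: (repr y) (repr z) => {y z} u w /cell_pt[umax umin] /cell_pt[wmax wmin].
  have l0 : 0 <= l%:num by [].
  have l1 : 0 <= 1 - l%:num by rewrite subr_ge0.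
  exists (pt (l%:num *: u + (1 - l%:num) *: w)).
    apply/cell_pt; split=> i j k h.
      have := ler_wpM2l l0 (umax _ _ k h); have := ler_wpM2l l1 (wmax _ _ k h).
      by rewrite !mxE; lra.
    have := ler_wpM2l l0 (umin _ _ k h); have := ler_wpM2l l1 (wmin _ _ k h).
    by rewrite !mxE; lra.
  (* The abstract convex combination unfolds to this formula by conversion. *)
  change (chart (pt (l%:num *: u + (1 - l%:num) *: w)) =
    l%:num *: chart (pt u) + (1 - l%:num) *: chart (pt w)).
  by rewrite !chart_pt; apply/rowP => j; rewrite !mxE; lra.
move=> u w a b /cell_pt[umax umin] /cell_pt[wmax wmin].
apply/cell_pt; split=> i j k h.
  have := umax _ _ k h; have := wmax _ _ k h; rewrite !mxE.
  by case: (leP (a + u 0 j)); case: (leP (a + u 0 k)); lra.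
have := umin _ _ k h; have := wmin _ _ k h; rewrite !mxE.
by case: (leP (a + u 0 j)); case: (leP (a + u 0 k)); lra.
Qed.

End FermatWeber.

Theorem theorem1 (R : realType) (d n : nat) (p : 'I_n -> torus R d)
    (V : 'M[R]_(n, d.+1)) (hV : forall i : 'I_n, pt (row i V) = p i) :
  polytrope (fermat_weber p) /\
  BCD V (fermat_weber p) /\
  (forall C : set (torus R d),
     maximal_set [set B | BCD V B /\ B `<=` fermat_weber p] C
     <-> C = fermat_weber p).
Proof.
have fwBCD := fermat_weber_cell hV.
split; first by have [x _ <-] := fwBCD; exact: cell_polytrope.
(* Being itself a cell, the Fermat-Weber set is the greatest element of the family, hence its only
   maximal one. *)
split=> // C; split=> [[[_ CFW] Cmax]|->].
  by apply/esym/Cmax => //; split.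
split; first by split.
by move=> B [_ BFW] FWB; apply/seteqP; split.
Qed.
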